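(* Let $\mathcal T$ be a set of tile designs, with $t_{\mathrm{id}}$ tiles, for the triakis tetrahedron with symmetry group the rotational tetrahedral group $T$ (order $12$). Then the number of ways of tiling the faces of the triakis tetrahedron up to rotational tetrahedral symmetry $T$ is $$\frac{1}{12}\left(t_{\mathrm{id}}^{12}+8\,t_{\mathrm{id}}^4+3\,t_{\mathrm{id}}^6\right).$$
   Context: Tilings. Let $P$ be a polyhedron with set of faces $\mathcal F$ and let $\mathcal A$ be a group of isometries of $P$, acting on $\mathcal F$. A set of tile designs is a finite set $\mathcal T$ together with a group action of $\mathcal A$ on $\mathcal T\times\mathcal F$ lying over the action on $\mathcal F$ (so $A\cdot(D,F)=(D',A\cdot F)$ for some $D'\in\mathcal T$); write $t_{\mathrm{id}}=|\mathcal T|$. A tiling is a map $\tau:\mathcal F\to\mathcal T$; $\mathcal A$ acts on tilings by moving graphs: $A\cdot\tau$ is the tiling with $((A\cdot\tau)(A\cdot F),A\cdot F)=A\cdot(\tau(F),F)$ for all $F$. The number of ways of tiling up to $\mathcal A$ is the number of $\mathcal A$-orbits on the set of tilings. Polyhedron and group. Let $T_d$ be the group of order $24$ generated by the matrices $R_0=\begin{pmatrix}0&1&0\\1&0&0\\0&0&1\end{pmatrix}$, $R_1=\begin{pmatrix}1&0&0\\0&0&1\\0&1&0\end{pmatrix}$, $R_2=\begin{pmatrix}0&-1&0\\-1&0&0\\0&0&1\end{pmatrix}$. Here $\mathcal A=T=\{A\in T_d:\det A=1\}$, of order $12$. The triakis tetrahedron (the Catalan solid dual to the truncated tetrahedron)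 is the convex hull of the $T_d$-orbits of $(1,1,1)$ and $(-3/5,-3/5,-3/5)$ ($8$ vertices, $12$ isosceles triangular faces). *)

(* Defs.v *)
From HB Require Import structures.
From mathcomp Require Import all_boot all_order all_algebra.
From mathcomp Require Import all_classical all_reals.
From mathcomp Require Import convex.

Set Implicit Arguments.
Unset Strict Implicit.
Unset Printing Implicit Defensive.

Import Order.TTheory GRing.Theory Num.Theory.

Local Open Scope classical_set_scope.
Local Open Scope ring_scope.

Section Polyhedra.
Variable R : realType.
Implicit Types (P X : set 'cV[R]_3) (A : 'M[R]_3).

Definition convex_hull X : set 'cV[R]_3 :=
  smallest (@convex_set R 'cV[R]_3) X.

(* The faces are the two-dimensional ones: intersections of P with a
   supporting plane n . x = c (n != 0) that contain three non-collinear
   points. *)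
Definition faces P : set (set 'cV[R]_3) :=
  [set F | exists (n : 'cV[R]_3) (c : R),
     [/\ n != 0,
         (forall x, P x -> (n^T *m x) 0 0 <= c),
         F = [set x | P x /\ (n^T *m x) 0 0 = c]
       & exists x y z, [/\ F x, F y, F z
                         & \rank (row_mx (y - x) (z - x)) = 2%N]]].

Definition mx_group (G : set 'M[R]_3) : Prop :=
  [/\ G 1%:M,
      (forall A B, G A -> G B -> G (A *m B))
    & (forall A, G A -> A \in unitmx /\ G (invmx A))].

Definition generated_group (S : set 'M[R]_3) : set 'M[R]_3 :=
  smallest mx_group S.

Definition orbit_of (G : set 'M[R]_3) (v : 'cV[R]_3) : set 'cV[R]_3 :=
  [set A *m v | A in G].

End Polyhedra.

Section Tilings.
Variables (R : realType) (P : set 'cV[R]_3) (G : set 'M[R]_3) (T : finType).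
Variable act : 'M[R]_3 -> T * faces P -> T * faces P.

(* act is an action of the group G on (tile designs) x (faces) lying over the
   action F |-> A F on faces; its values at matrices outside G are irrelevant.
   faces P is used here as a type (through set_type), and val forgets the proof
   of being a face. *)
Definition tile_action : Prop :=
  [/\ (forall p, act 1%:M p = p),
      (forall A B, G A -> G B -> forall p, act (A *m B) p = act A (act B p))
    & (forall A, G A -> forall (D : T) (F : faces P),
         val (act A (D, F)).2 = [set A *m x | x in val F])].

Definition tiling : Type := faces P -> T.

Definition tiling_graph (tau : tiling) : set (T * faces P) :=
  [set p | p.1 = tau p.2].

Definition tiling_orbit (tau : tiling) : set tiling :=
  [set tau' | exists2 A, G A &
     tiling_graph tau' = [set act A p | p in tiling_graph tau]].

Definition tiling_orbits : set (set tiling) := range tiling_orbit.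

End Tilings.

Section Triakis.
Variable R : realType.

Definition mx3 (s : seq (seq R)) : 'M[R]_3 :=
  \matrix_(i < 3, j < 3) nth 0 (nth [::] s i) j.

Definition R0 : 'M[R]_3 :=
  mx3 [:: [:: 0; 1; 0];
          [:: 1; 0; 0];
          [:: 0; 0; 1]].
Definition R1 : 'M[R]_3 :=
  mx3 [:: [:: 1; 0; 0];
          [:: 0; 0; 1];
          [:: 0; 1; 0]].
Definition R2 : 'M[R]_3 :=
  mx3 [:: [:: 0; -1; 0];
          [:: -1; 0; 0];
          [:: 0; 0; 1]].

Definition full_tetrahedral_group : set 'M[R]_3 :=
  generated_group [set R0; R1; R2].

Definition rotational_tetrahedral_group : set 'M[R]_3 :=
  [set A | full_tetrahedral_group A /\ \det A = 1].

Definition triakis_tetrahedron : set 'cV[R]_3 :=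
  convex_hull (orbit_of full_tetrahedral_group (const_mx 1) `|`
               orbit_of full_tetrahedral_group (const_mx (- (3 / 5)))).

End Triakis.

(* These are sets, hence functions, so R would otherwise become implicit. *)
Arguments full_tetrahedral_group R : clear implicits.
Arguments rotational_tetrahedral_group R : clear implicits.
Arguments triakis_tetrahedron R : clear implicits.

(* Main.v *)
Require Import Defs.
From HB Require Import structures.
From mathcomp Require Import all_boot all_order all_fingroup all_algebra.
From mathcomp Require Import cyclic alt.
From mathcomp Require Import all_classical all_reals.
From mathcomp Require Import interval_inference convex ring lra.

(** The rotation group acts simply transitively on the 12 faces, and this is
    all that matters about the polyhedron.  A face can then be named by the
    rotation carrying a base face to it, and the tile action can be
    straightened: transporting every tile back to the base face turns tilings
    into functions from the group to the set of designs, and the action on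
    tilings into translation of functions ([graph_act_gauge]).  A function is
    fixed by translation by [g] exactly when it is constant on the cosets of
    the subgroup generated by [g], so Burnside's lemma gives, for a group of
    order 12, one twelfth of the sum of t ^ (12 / order of g)
    ([card_tiling_orbits_regular]).  The group being the alternating group on
    the four vertices of a tetrahedron, it contains the identity, eight
    elements of order 3 and three of order 2 ([sum_alt4_order]).

    The geometry is organised around the isomorphism from the symmetric group
    S_4 to the full tetrahedral group.  Let V be the 3 x 4 matrix whose columns
    are the vertices v_0, ..., v_3 of the regular tetrahedron.  Then
    V V^T = 4 and V^T V = 4 - J, with J the all-ones matrix and V J = 0; hence
    s |-> V (perm_mx s) V^T / 4 is multiplicative, its image is generated by
    the images of transpositions, and its determinant is the signature.  So the
      rotations
    are the image of A_4.

    The polyhedron is the convex hull of the v_j and of the apexes -3/5 v_j.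
    It is also cut out by the 12 inequalities n_kl . x <= 3, with
    n_kl = -(2 v_k + v_l) and k <> l ([triakis_halfspaces]): if (k, l)
    maximises n_kl . x, then x is a nonnegative combination, of total weight
    n_kl . x / 3, of the three vertices of the face with normal n_kl.  A
    supporting plane through three noncollinear points of the polyhedron must
    be one of these 12 planes, because the centroid of the three points is on
    the boundary, hence on some plane n_kl . x = 3, which then contains all
    three points ([facesP]).  Thus faces correspond to ordered pairs of
    distinct elements of a set with four elements, and A_4 is regular on
    those. *)

Set Implicit Arguments.
Unset Strict Implicit.
Unset Printing Implicit Defensive.

Import Order.TTheory GRing.Theory Num.Theory.

(** * Burnside's lemma for a group translating functions on itself *)

Section TranslationAction.
Variables (gT : finGroupType) (T : finType).

(** A right action, hence the multiplication of the argument by [g] on the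
    left. *)
Definition translate (f : {ffun gT -> T}) (g : gT) : {ffun gT -> T} :=
  [ffun h => f (g * h)%g].

Lemma translate_is_action : is_action [set: gT] translate.
Proof.
split=> [g f1 f2 /ffunP eqf|f g1 g2 _ _]; apply/ffunP => h.
  by have := eqf (g^-1 * h)%g; rewrite !ffunE mulKVg.
by rewrite !ffunE mulgA.
Qed.

Canonical translation_action := Action translate_is_action.

(** A function invariant under translation by [g] is constant on the right
    cosets of [<[g]>], and is an arbitrary function of the coset. *)
Lemma card_fix_translation (g : gT) :
  #|('Fix_translation_action[g])%g| = (#|T| ^ (#|gT| %/ #[g]%g))%N.
Proof.
pose I := {C : {set gT} | C \in rcosets <[g]>%g [set: gT]}.
have rcI h : (<[g]> :* h)%g \in rcosets <[g]>%g [set: gT].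
  by apply/rcosetsP; exists h; rewrite ?inE.
pose cls h : I := Sub (<[g]> :* h)%g (rcI h).
have cls_repr (C : I) : cls (repr (val C)) = C.
  case: C => C inC; apply: val_inj => /=.
  by case/rcosetsP: inC => h _ ->; apply: rcoset_repr.
pose F (u : {ffun I -> T}) : {ffun gT -> T} := [ffun h => u (cls h)].
have F_inj : injective F.
  move=> u1 u2 /ffunP eqF; apply/ffunP => C.
  by have := eqF (repr (val C)); rewrite !ffunE cls_repr.
have -> : 'Fix_translation_action[g]%g = [set F u | u in [set: {ffun I -> T}]].
  apply/setP => f; apply/afix1P/imsetP => [fixf|[u _ ->]]; last first.
    apply/ffunP => h; rewrite !ffunE; congr (u _); apply: val_inj => /=.
    by apply/rcoset_eqP/rcosetP; exists g; rewrite ?cycle_id.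
  have fixX n h : f (g ^+ n * h)%g = f h.
    elim: n => [|n IHn]; first by rewrite expg0 mul1g.
    by rewrite expgS -mulgA -IHn -[in RHS]fixf ffunE.
  exists [ffun C => f (repr (val C))] => //; apply/ffunP => h;
    rewrite !ffunE /=.
  by have /rcosetP[_ /cycleP[n ->] ->] := mem_repr_rcoset <[g]>%G h;
    rewrite fixX.
rewrite card_imset // cardsT card_ffun; congr (_ ^ _)%N.
by rewrite card_sig -(cardsT gT) orderE divgS ?finset.subsetT //.
Qed.

Lemma card_translation_orbits :
  (#|[set orbit translation_action [set: gT] f | f in [set: {ffun gT -> T}]]|
    * #|gT| = \sum_(g : gT) #|T| ^ (#|gT| %/ #[g]%g))%N.
Proof.
have actsT : [acts [set: gT], on [set: {ffun gT -> T}] | translation_action]%g.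
  by apply/actsP => g _ f; rewrite !inE.
rewrite -(cardsT gT) -(Frobenius_Cauchy actsT); apply: eq_big => [g|g _].
  by rewrite inE.
by rewrite finset.setTI card_fix_translation cardsT.
Qed.

End TranslationAction.

(** * Orders of the elements of the alternating group on four points *)

Local Notation A4 := ('Alt_('I_4))%g.

Section Alternating4.
Implicit Types (a b c d x : 'I_4) (s : {perm 'I_4}).

Definition quadruple a b c d :=
  [&& a != b, a != c, a != d, b != c, b != d & c != d] /\
  forall x, x \in [:: a; b; c; d].

Lemma quadrupleP a b : a != b -> exists c d, quadruple a b c d.
Proof.
move=> neq_ab; have : #|~: [set a; b]| == 2%N.
  by have := cardsC [set a; b]; rewrite cards2 neq_ab card_ord => /(@addnI 2)->.
case/cards2P=> c [d [neq_cd defC]]; exists c, d.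
have := finset.in_setC c [set a; b]; have := finset.in_setC d [set a; b].
rewrite /quadruple defC !inE !eqxx orbT !negb_or (eq_sym c a) (eq_sym c b).
rewrite (eq_sym d a) (eq_sym d b) => /esym/andP[-> ->] /esym/andP[-> ->].
split=> [|x]; first by rewrite neq_ab neq_cd.
have := finset.in_setC x [set a; b]; rewrite defC !inE => /esym.
by case: (x == a) (x == b) => -[].
Qed.

Lemma quadruple_sum (V : nmodType) (F : 'I_4 -> V) a b c d :
  quadruple a b c d -> (\sum_x F x = F a + F b + F c + F d)%R.
Proof.
move=> [/and5P[ab ac ad bc /andP[bd cd]] abcd].
have uniq4 : uniq [:: a; b; c; d].
  by rewrite /= !inE !negb_or ab ac ad bc bd cd.
transitivity (\sum_(x <- [:: a; b; c; d]) F x)%R.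
  by rewrite (big_uniq _ uniq4); apply: eq_bigl => x; rewrite abcd.
by rewrite !big_cons big_nil addr0 !addrA.
Qed.

(** The only permutations fixing [a] and [b] are the identity and the
    transposition of the other two points, which is odd. *)
Lemma alt4_fix2 s a b :
  a != b -> s \in A4 -> s a = a -> s b = b -> s = 1%g.
Proof.
move=> neq_ab; rewrite Alt_even => s_even sa sb.
have [c [d [/and5P[_ ac ad bc /andP[bd cd]] abcd]]] := quadrupleP neq_ab.
have neq_s x y : x != y -> s x != s y by rewrite (inj_eq perm_inj).
have [sc|sc] := eqVneq (s c) c.
  apply/permP => x; rewrite perm1; have := abcd (s d).
  have := neq_s _ _ ad; have := neq_s _ _ bd; have := neq_s _ _ cd.
  rewrite sa sb sc !inE !(eq_sym _ (s d)) => /negPf-> /negPf-> /negPf-> /eqP sd.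
  by have := abcd x; rewrite !inE => /or4P[]/eqP->.
have sc_d : s c = d.
  have := abcd (s c); have := neq_s _ _ ac; have := neq_s _ _ bc.
  rewrite sa sb !inE !(eq_sym _ (s c)) => /negPf-> /negPf->.
  by rewrite (negPf sc) => /eqP.
have sd_c : s d = c.
  have := abcd (s d); have := neq_s _ _ ad; have := neq_s _ _ bd.
  have := neq_s _ _ cd; rewrite sa sb sc_d !inE !(eq_sym _ (s d)).
  by move=> /negPf-> /negPf-> /negPf->; rewrite orbF => /eqP.
case/negP: s_even; suff -> : s = tperm c d by rewrite odd_tperm cd.
apply/permP => x; have := abcd x; rewrite !inE => /or4P[]/eqP->.
- by rewrite tpermD // eq_sym.
- by rewrite tpermD // eq_sym.
- by rewrite tpermL.
- by rewrite tpermR.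
Qed.

(** Some permutation does it; if it is odd, composing it with the transposition
    of the two points other than [c] and [d] makes it even. *)
Lemma alt4_trans2 a b c d : a != b -> c != d ->
  exists2 s, s \in A4 & s a = c /\ s b = d.
Proof.
move=> neq_ab neq_cd.
have [s [sa sb]] : exists s, s a = c /\ s b = d.
  exists (tperm a c * tperm (tperm a c b) d)%g.
  split; last by rewrite permM tpermL.
  rewrite permM tpermL; apply: tpermD; last by rewrite eq_sym.
  by rewrite -[X in _ != X](tpermL a c) (inj_eq perm_inj) eq_sym.
have [e [f [/and5P[_ ce cf de /andP[df ef]] _]]] := quadrupleP neq_cd.
have [odd_s|even_s] := boolP (odd_perm s); last by exists s; rewrite ?Alt_even.
exists (s * tperm e f)%g; first by rewrite Alt_even odd_permM odd_s odd_tperm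
  ef.
by rewrite !permM sa sb !tpermD // eq_sym.
Qed.

Lemma card_alt4 : #|A4| = 12%N.
Proof.
have : (2 * #|A4| = 4`!)%N by rewrite card_Alt card_ord.
by rewrite (_ : 4`! = 2 * 12)%N // => /eqP; rewrite eqn_pmul2l // => /eqP.
Qed.

Lemma alt4_transitive : [transitive A4, on [set: 'I_4] | 'P]%g.
Proof.
apply/imsetP; exists ord0; rewrite ?inE //; apply/esym/setP => x; rewrite inE.
have [->|nz] := eqVneq x ord0; first exact: orbit_refl.
have ne0 : ord0 != ord_max :> 'I_4 by [].
have [s sA [<- _]] := alt4_trans2 ne0 nz.
by apply/imsetP; exists s.
Qed.

Lemma alt4_not_4cycle s a b c d :
  quadruple a b c d -> s \in A4 -> s a = b -> s b = c -> s c = d -> False.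
Proof.
move=> [/and5P[ab ac ad bc /andP[bd cd]] abcd]; rewrite Alt_even => s_even.
move=> sa sb sc; have neq_s x y : x != y -> s x != s y by rewrite (inj_eq
  perm_inj).
have sd : s d = a.
  have := abcd (s d); have := neq_s _ _ ad; have := neq_s _ _ bd.
  have := neq_s _ _ cd; rewrite sa sb sc !inE !(eq_sym _ (s d)).
  by move=> /negPf-> /negPf-> /negPf->; rewrite !orbF => /eqP.
case/negP: s_even.
(* A 4-cycle is a product of three transpositions. *)
suff -> : s = (tperm a b * tperm a c * tperm a d)%g.
  by rewrite !odd_permM !odd_tperm ab ac ad.
apply/permP => x; rewrite !permM; have := abcd x; rewrite !inE => /or4P[]/eqP->.
- by rewrite sa tpermL !tpermD // eq_sym.
- by rewrite sb tpermR tpermL tpermD // eq_sym.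
- by rewrite sc (tpermD ac) // tpermR tpermL.
- by rewrite sd (tpermD ad) // (tpermD ad) // tpermR.
Qed.

(** The cycle type of [s] has no 1, so it is (4) or (2, 2), and a 4-cycle is
    odd. *)
Lemma alt4_involution s :
  s \in A4 -> (forall x, s x != x) -> (s ^+ 2 = 1)%g.
Proof.
move=> sA nfix; pose a : 'I_4 := ord0.
have neq_ab : a != s a by rewrite eq_sym.
have eq_s x y : s x = s y -> x = y by apply: perm_inj.
(* The image [c] of [s a] cannot be a third point: [s c] would be [a], leaving
   the fourth point [d] fixed, or [d], making [s] a 4-cycle. *)
have no_path c d : quadruple a (s a) c d -> s (s a) <> c.
  move=> abcd ssa; have [/and5P[_ ac ad bc /andP[bd cd]] all4] := abcd.
  have := all4 (s c); rewrite !inE => /or4P[]/eqP sc.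
  - have /negP := nfix d; apply; have := all4 (s d); rewrite !inE.
    case/or4P=> // /eqP sd.
    + by move: cd; rewrite (eq_s c d) ?eqxx // sc.
    + by move: ad; rewrite (eq_s a d) ?eqxx // sd.
    + by move: bd; rewrite (eq_s (s a) d) ?eqxx // sd.
  - by move: ac; rewrite (eq_s a c) ?eqxx // sc.
  - by have := nfix c; rewrite sc eqxx.
  - exact: (alt4_not_4cycle abcd sA (erefl _) ssa sc).
suff ssa : s (s a) = a.
  by apply: (alt4_fix2 neq_ab); rewrite ?groupX // !permX /= ?ssa.
have [c [d abcd]] := quadrupleP neq_ab.
have := abcd.2 (s (s a)); rewrite !inE => /or4P[]/eqP // ssa.
- by have := nfix (s a); rewrite ssa eqxx.
- by case: (no_path _ _ abcd).
- case: (no_path d c) => //.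
  case: abcd => /and5P[ab ac ad bc /andP[bd cd]] all4.
  split=> [|x]; first by rewrite ab ac ad bc bd eq_sym.
  by have := all4 x; rewrite !inE (orbC (x == c)).
Qed.

(** A nontrivial element fixing a point fixes no other one and lies in the
    stabiliser of that point, which has 12 / 4 = 3 elements; for the others,
    see [alt4_involution]. *)
Lemma alt4_order s : s \in A4 -> s != 1%g ->
  [\/ #|'Fix_'P[s]%g| = 1%N /\ #[s]%g = 3%N |
      #|'Fix_'P[s]%g| = 0%N /\ #[s]%g = 2%N].
Proof.
move=> sA s1.
have [/existsP[i /eqP si]|/existsPn nfix] := boolP [exists i, s i == i].
  left; split.
    rewrite (_ : 'Fix_'P[s]%g = [set i]) ?cards1 //.
    apply/setP => x; rewrite inE; apply/afix1P/eqP => [sx|->//].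
    by apply: contraNeq s1 => neq_xi; apply/eqP/(alt4_fix2 neq_xi).
  apply: nt_prime_order => //; apply/eqP; rewrite -order_dvdn.
  have : s \in 'C_A4[i | 'P]%g by rewrite inE sA; apply/astab1P.
  move=> /order_dvdG; have := card_orbit_stab 'P A4 i.
  rewrite (atransP alt4_transitive) ?inE // cardsT card_ord card_alt4.
  by rewrite (_ : 12 = 4 * 3)%N // => /eqP; rewrite eqn_pmul2l // => /eqP->.
right; split; last by apply: nt_prime_order => //; apply: alt4_involution.
by apply: eq_card0 => x; apply/negbTE/afix1P/eqP/nfix.
Qed.

Lemma sum_alt4_fix : (\sum_(s in A4) #|'Fix_'P[s]%g| = 12)%N.
Proof.
have actsT : [acts A4, on [set: 'I_4] | 'P]%g by apply/actsP => g _ f;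
  rewrite !inE.
have := Frobenius_Cauchy actsT; rewrite card_alt4.
rewrite (_ : [set orbit _ _ _ | _ in _] = [set [set: 'I_4]]) ?cards1;
  last first.
  apply/setP => C; rewrite inE; apply/imsetP/eqP => [[x _ ->]|->].
    by rewrite (atransP alt4_transitive) ?inE.
  by exists ord0; rewrite ?inE // (atransP alt4_transitive) ?inE.
by rewrite mul1n => <-; apply: eq_bigr => s _; rewrite finset.setTI.
Qed.

(** By [alt4_order] the number of fixed points of a nontrivial element tells its
    order, so the count of the elements of each order follows from that of
    the pairs (element, fixed point): 12 of these, 4 of which come from the
    identity, so 8 nontrivial elements fix a point and 12 - 1 - 8 = 3 do
    not. *)
Lemma sum_alt4_order t :
  (\sum_(s in A4) t ^ (12 %/ #[s]%g) = t ^ 12 + 8 * t ^ 4 + 3 * t ^ 6)%N.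
Proof.
have s1A : 1%g \in A4 by apply: group1.
(* On nontrivial elements, [F] is the indicator of those of order 3 and [1 - F]
   of those of order 2. *)
pose F s := #|'Fix_'P[s]%g|.
have F1 : F 1%g = 4%N.
  by rewrite -[RHS](card_ord 4); apply: eq_card => x; apply/afix1P;
    rewrite act1.
have sumF : (\sum_(s in A4 | s != 1%g) F s = 8)%N.
  by have := sum_alt4_fix; rewrite (bigD1 1%g) //= -/(F 1%g) F1 => /(@addnI 4 _
    8).
have sumF' : (\sum_(s in A4 | s != 1%g) (1 - F s) = 3)%N.
  apply: (@addnI 8); rewrite -[(8 + 3)%N]/11%N -{1}sumF -big_split /=.
  have := card_alt4; rewrite -sum1_card (bigD1 1%g) //= => /(@addnI 1 _ 11) <-.
  apply: eq_bigr => s /andP[sA s1]; rewrite /F.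
  by case: (alt4_order sA s1) => -[-> _].
rewrite (bigD1 1%g) //= order1 divn1 -addnA; congr (_ + _)%N.
transitivity ((\sum_(s in A4 | s != 1%g) F s) * t ^ 4
              + (\sum_(s in A4 | s != 1%g) (1 - F s)) * t ^ 6)%N; last first.
  by rewrite sumF sumF'.
rewrite !big_distrl -big_split /=; apply: eq_bigr => s /andP[sA s1].
by rewrite /F; case: (alt4_order sA s1) => -[-> ->];
  rewrite ?mul1n ?mul0n ?addn0.
Qed.

End Alternating4.

Local Open Scope classical_set_scope.
Local Open Scope ring_scope.

(** * Straightening a tile action over a regular action on faces *)

Lemma card_eq_finset (U : finType) (B : {set U}) : ([set` B] #= `I_#|B|)%card.
Proof.
have -> : `I_#|B| = [set index x (enum B) | x in [set` B]].
  apply/seteqP; split=> [k kB|_ [x xB <-]]; last first.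
    by rewrite /= cardE index_mem mem_enum.
  exists (enum_val (Ordinal kB)); first exact: enum_valP.
  by rewrite /enum_val index_uniq ?enum_uniq -?cardE.
apply/card_esym/inj_card_eq => x y; rewrite !inE /= => xB yB.
by apply: (index_inj x); rewrite mem_enum.
Qed.

Section Gauge.
Variables (R : realType) (P : set 'cV[R]_3) (G : set 'M[R]_3) (T : finType).
Variable act : 'M[R]_3 -> T * faces P -> T * faces P.
Hypothesis hact : tile_action G act.
Variables (gT : finGroupType) (M : gT -> 'M[R]_3) (face : gT -> faces P).
Hypothesis M1 : M 1%g = 1%:M.
Hypothesis MM : forall g h, M (g * h)%g = M g *m M h.
Hypothesis rangeM : range M = G.
Hypothesis face_bij : bijective face.
Hypothesis faceM : forall g h,
  val (face (g * h)%g) = [set M g *m x | x in val (face h)].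

Let GM g : G (M g). Proof. by rewrite -rangeM; exists g. Qed.

Let actM g h p : act (M (g * h)%g) p = act (M g) (act (M h) p).
Proof. by rewrite MM; case: hact => _ -> . Qed.

Let act1 p : act (M 1%g) p = p.
Proof. by rewrite M1; case: hact. Qed.

Lemma act_face g h D :
  act (M g) (D, face h) = ((act (M g) (D, face h)).1, face (g * h)%g).
Proof.
rewrite [LHS]surjective_pairing; congr (_, _); apply: val_inj.
by rewrite faceM; case: hact => _ _ ->.
Qed.

(** The tile [(D, face h)], brought back to the base face [face 1]. *)
Definition design_gauge h D := (act (M h^-1%g) (D, face h)).1.

Lemma design_gaugeK h D : act (M h) (design_gauge h D, face 1%g) = (D, face h).
Proof.
have := act_face h^-1%g h D; rewrite mulVg -/(design_gauge h D) => <-.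
by rewrite -actM mulgV act1.
Qed.

Lemma design_gauge_inj h : injective (design_gauge h).
Proof.
move=> D1 D2 eqD; have := design_gaugeK h D1; rewrite eqD design_gaugeK.
by case.
Qed.

(** The gauge absorbs the action: moving a tile by [g] before bringing it back
    changes nothing. *)
Lemma design_gauge_act g h D :
  design_gauge (g * h)%g (act (M g) (D, face h)).1 = design_gauge h D.
Proof. by rewrite /design_gauge -act_face -actM invMg mulgKV. Qed.

Definition gauge (tau : tiling P T) : {ffun gT -> T} :=
  [ffun h => design_gauge h (tau (face h))].

Lemma gauge_surj f : exists tau, gauge tau = f.
Proof.
have [faceV faceK _] := face_bij.
exists (fun F => (act (M (faceV F)) (f (faceV F), face 1%g)).1).
apply/ffunP => h; rewrite ffunE faceK; have := design_gauge_act h 1%g (f h).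
by rewrite mulg1 => ->; rewrite /design_gauge invg1 act1.
Qed.

(** Since [design_gauge] is invariant, all that remains of the action of [g] on
    tilings is the relabelling of faces by [h |-> g * h]. *)
Lemma graph_act_gauge g tau tau' :
  tiling_graph tau' = [set act (M g) p | p in tiling_graph tau] <->
  gauge tau = translate (gauge tau') g.
Proof.
have [faceV faceK faceVK] := face_bij; split=> [eqgr|/ffunP eqg].
  apply/ffunP => h; rewrite !ffunE -(design_gauge_act g).
  have : tiling_graph tau' (act (M g) (tau (face h), face h)).
    by rewrite eqgr; exists (tau (face h), face h).
  by rewrite act_face => ->.
have act_tau h : act (M g) (tau (face h), face h) =
    (tau' (face (g * h)%g), face (g * h)%g).
  rewrite act_face; congr (_, _); apply: (@design_gauge_inj (g * h)%g).
  by rewrite design_gauge_act; have := eqg h; rewrite !ffunE.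
apply/seteqP; split=> [[D F] inF|_ [[D F] inF <-]].
  have -> : D = tau' F := inF.
  rewrite -(faceVK F); set h := faceV F.
  exists (tau (face (g^-1 * h)%g), face (g^-1 * h)%g) => //.
  by rewrite act_tau mulKVg.
by have -> : D = tau F := inF; rewrite -(faceVK F) act_tau.
Qed.

Lemma tiling_orbit_gauge tau tau' : tiling_orbit G act tau tau' <->
  gauge tau' \in orbit (translation_action gT T) [set: gT]%SET (gauge tau).
Proof.
split=> [[A] | /imsetP[g _ eqg]].
  rewrite -rangeM => -[g _ <-] /graph_act_gauge ->.
  by rewrite orbit_sym mem_orbit ?inE.
exists (M g^-1%g) => //; apply/graph_act_gauge.
by rewrite eqg; apply/ffunP => h; rewrite !ffunE mulKVg.
Qed.

(** Orbits of tilings are the preimages under [gauge], which is onto, of the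
    orbits of translation. *)
Theorem card_tiling_orbits_regular : exists N,
  (tiling_orbits G act #= `I_N)%card /\
  (N * #|gT| = \sum_(g : gT) #|T| ^ (#|gT| %/ #[g]%g))%N.
Proof.
pose B := [set orbit (translation_action gT T) [set: gT] f
            | f in [set: {ffun gT -> T}]]%SET.
exists #|B|; split; last exact: card_translation_orbits.
have -> : tiling_orbits G act =
    [set gauge @^-1` [set` (C : {set {ffun gT -> T}})] | C in [set` B]].
  apply/seteqP; split=> [_ [tau _ <-]|_ [C /= /imsetP[f _ ->] <-]].
    exists (orbit (translation_action gT T) [set: gT]%SET (gauge tau)) => /=.
      by apply: imset_f; rewrite inE.
    by apply/seteqP; split=> tau' /=; rewrite -tiling_orbit_gauge.
  have [tau <-] := gauge_surj f; exists tau => //.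
  by apply/seteqP; split=> tau' /=; rewrite -tiling_orbit_gauge.
apply: card_eq_trans (card_eq_finset B);
  apply: inj_card_eq => C D _ _ /seteqP eqCD.
apply/setP => f; have [tau <-] := gauge_surj f.
by case: eqCD => CD DC; apply/idP/idP; [exact: CD|exact: DC].
Qed.

End Gauge.

(** * The tetrahedral groups as matrix images of S_4 and A_4 *)

Local Notation ord4 k := (@Ordinal 4 k isT).

Section TetrahedralGroup.
Variable R : realType.
Implicit Types (s t : {perm 'I_4}) (A : 'M[R]_3).

(** The columns are (1,1,1), (1,-1,-1), (-1,1,-1) and (-1,-1,1). *)
Definition tetra : 'M[R]_(3, 4) :=
  \matrix_(i, j) if (j == 0 :> nat) || (j == i.+1 :> nat) then 1 else -1.

Lemma tetra_mul_tr : tetra *m tetra^T = 4%:M.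
Proof.
apply/matrixP => -[[|[|[|i]]] //= ?] [[|[|[|j]]] //= ?];
  by rewrite !mxE !big_ord_recl big_ord0 !mxE /=; lra.
Qed.

Lemma tetra_tr_mul : tetra^T *m tetra = 4%:M - const_mx 1.
Proof.
apply/matrixP => -[[|[|[|[|i]]]] //= ?] [[|[|[|[|j]]]] //= ?];
  by rewrite !mxE !big_ord_recl big_ord0 !mxE /=; lra.
Qed.

Lemma tetra_mul_const n : tetra *m const_mx 1 = 0 :> 'M_(3, n).
Proof.
apply/matrixP => -[[|[|[|i]]] //= ?] j;
  by rewrite !mxE !big_ord_recl big_ord0 !mxE /=; lra.
Qed.

(** The columns of [tetra] span the space. *)
Lemma tetra_inj A B : A *m tetra = B *m tetra -> A = B.
Proof.
move=> /(congr1 (mulmx^~ tetra^T)); rewrite -!mulmxA tetra_mul_tr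
  !mul_mx_scalar.
by apply: scalerI; rewrite pnatr_eq0.
Qed.

(** The linear map permuting the columns of [tetra] as [s] does
    ([perm_isometry_tetra]); the factor 1/4 is that of [tetra_mul_tr]. *)
Definition perm_isometry s : 'M[R]_3 := 4^-1 *: (tetra *m perm_mx s *m tetra^T).

Lemma perm_isometry_tetra s : perm_isometry s *m tetra = tetra *m perm_mx s.
Proof.
rewrite -scalemxAl -!mulmxA tetra_tr_mul mulmxBr.
have -> : perm_mx s *m const_mx 1 = const_mx 1 :> 'M[R]_4.
  by rewrite -row_permE; apply/matrixP => i j; rewrite !mxE.
by rewrite mulmxBr tetra_mul_const subr0 mul_mx_scalar -scalemxAr scalerA mulVf
  ?pnatr_eq0 // scale1r.
Qed.

Lemma perm_isometry1 : perm_isometry 1 = 1%:M.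
Proof.
by apply: tetra_inj; rewrite perm_isometry_tetra perm_mx1 mulmx1 mul1mx.
Qed.

Lemma perm_isometryM s t :
  perm_isometry (s * t) = perm_isometry s *m perm_isometry t.
Proof.
apply: tetra_inj.
by rewrite -mulmxA !perm_isometry_tetra perm_mxM !mulmxA perm_isometry_tetra.
Qed.

Lemma perm_isometry_tr s : (perm_isometry s)^T = perm_isometry s^-1.
Proof.
by rewrite /perm_isometry linearZ /= !trmx_mul trmxK tr_perm_mx mulmxA.
Qed.

Lemma perm_isometry_tperm A a b :
  A *m tetra = col_perm (tperm a b) tetra -> A = perm_isometry (tperm a b).
Proof.
by rewrite col_permE tpermV -perm_isometry_tetra => /tetra_inj.
Qed.

Lemma R0_perm : R0 R = perm_isometry (tperm (ord4 1) (ord4 2)).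
Proof.
apply: perm_isometry_tperm.
by apply/matrixP => -[[|[|[|i]]] //= ?] [[|[|[|[|j]]]] //= ?];
  rewrite !mxE !big_ord_recl big_ord0 !mxE !permE /=; lra.
Qed.

Lemma R1_perm : R1 R = perm_isometry (tperm (ord4 2) (ord4 3)).
Proof.
apply: perm_isometry_tperm.
by apply/matrixP => -[[|[|[|i]]] //= ?] [[|[|[|[|j]]]] //= ?];
  rewrite !mxE !big_ord_recl big_ord0 !mxE !permE /=; lra.
Qed.

Lemma R2_perm : R2 R = perm_isometry (tperm (ord4 0) (ord4 3)).
Proof.
apply: perm_isometry_tperm.
by apply/matrixP => -[[|[|[|i]]] //= ?] [[|[|[|[|j]]]] //= ?];
  rewrite !mxE !big_ord_recl big_ord0 !mxE !permE /=; lra.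
Qed.

Lemma det_R0 : \det (R0 R) = -1.
Proof.
have -> : R0 R = perm_mx (tperm (@Ordinal 3 0 isT) (@Ordinal 3 1 isT)).
  by apply/matrixP => -[[|[|[|i]]] //= ?] [[|[|[|j]]] //= ?];
    rewrite !mxE !permE.
by rewrite det_perm odd_tperm.
Qed.

(** All transpositions are conjugate to the one giving [R0], whose matrix has
    determinant -1. *)
Lemma det_perm_isometry s : \det (perm_isometry s) = (-1) ^+ odd_perm s.
Proof.
have det_tperm a b : a != b -> \det (perm_isometry (tperm a b)) = -1.
  have ne12 : ord4 1 != ord4 2 by [].
  move=> /(alt4_trans2 ne12)[r _ [<- <-]].
  rewrite -tpermJ conjgE !perm_isometryM !det_mulmx mulrCA -det_mulmx
    -perm_isometryM.
  by rewrite mulVg perm_isometry1 det1 mulr1 -R0_perm det_R0.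
have [ts -> /allP ts_neq] := prod_tpermP s.
elim: ts ts_neq => [|[a b] ts IHts] ts_neq.
  by rewrite big_nil perm_isometry1 det1 odd_perm1.
rewrite big_cons perm_isometryM det_mulmx odd_permM odd_tperm signr_addb.
have neq_ab : a != b := ts_neq (a, b) (mem_head _ _).
rewrite IHts => [|x x_ts]; last by rewrite ts_neq ?inE ?x_ts ?orbT.
by rewrite det_tperm //= neq_ab.
Qed.

(** [R0], [R1], [R2] come from the transpositions (1 2), (2 3), (0 3), which
    generate S_4: the transpositions (3 y) do, and only (3 1) is missing, which
    is conjugate to (1 2) by (2 3). *)
Lemma full_tetrahedral_groupE :
  full_tetrahedral_group R = range perm_isometry.
Proof.
apply/seteqP; split.
  apply: smallest_sub; last first.
    by move=> _ [[]->|->]; [rewrite R0_perm|rewrite R1_perm|rewrite R2_perm];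
      eexists.
  split=> [|_ _ [s _ <-] [t _ <-]|_ [s _ <-]].
  - by exists 1%g => //; rewrite perm_isometry1.
  - by exists (s * t)%g => //; rewrite perm_isometryM.
  have sK : perm_isometry s *m perm_isometry s^-1 = 1%:M.
    by rewrite -perm_isometryM mulgV perm_isometry1.
  have [uA _] := mulmx1_unit sK; split=> //; exists (s^-1)%g => //.
  by rewrite -[LHS](mulKmx uA) sK mulmx1.
move=> _ [s _ <-] K [[K1 KM _] genK].
pose H := [set r : {perm 'I_4} | `[< K (perm_isometry r) >]]%SET.
have gH : group_set H.
  apply/group_setP; split=> [|r t]; rewrite !inE.
    by rewrite perm_isometry1.
  by rewrite perm_isometryM; apply: KM.
have K0 : tperm (ord4 1) (ord4 2) \in H.
  by rewrite !inE -R0_perm; apply: genK; left; left.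
have K1' : tperm (ord4 2) (ord4 3) \in H.
  by rewrite !inE -R1_perm; apply: genK; left; right.
have K2 : tperm (ord4 0) (ord4 3) \in H.
  by rewrite !inE -R2_perm; apply: genK; right.
have : <<[set tperm (ord4 3) y | y in 'I_4]%SET>>%g \subset Group gH.
  rewrite gen_subG; apply/fintype.subsetP => _ /imsetP[y _ ->] /=.
  case: y => [[|[|[|[|y]]]] //= y4].
  - rewrite tpermC (_ : Ordinal y4 = ord4 0) //; exact: val_inj.
  - have -> : tperm (ord4 3) (Ordinal y4) =
        (tperm (ord4 1) (ord4 2) ^ tperm (ord4 2) (ord4 3))%g.
      rewrite tpermJ tpermL tpermD // tpermC; congr tperm; exact: val_inj.
    exact: (@groupJ _ (Group gH)).
  - rewrite tpermC (_ : Ordinal y4 = ord4 2) //; exact: val_inj.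
  - rewrite (_ : Ordinal y4 = ord4 3) ?tperm1 ?(group1 (Group gH)) //.
    exact: val_inj.
rewrite gen_tperm => /fintype.subsetP/(_ s); rewrite inE => /(_ isT).
by rewrite !inE.
Qed.

Lemma rotational_tetrahedral_groupE :
  rotational_tetrahedral_group R = [set perm_isometry s | s in [set` A4]].
Proof.
rewrite /rotational_tetrahedral_group full_tetrahedral_groupE.
have detE s : \det (perm_isometry s) = 1 <-> s \in A4.
  rewrite det_perm_isometry Alt_even; case: (odd_perm s); split=> //.
  by move=> /eqP; rewrite eq_sym -subr_eq0 opprK (pnatr_eq0 _ 2).
apply/seteqP; split=> [_ [[s _ <-] /detE sA]|_ [s /detE sA <-]];
  first by exists s.
by split=> //; exists s.
Qed.

End TetrahedralGroup.

(** * Convex sets containing the origin *)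

Section ConvexSets.
Variable R : realType.

Lemma convex_setP (C : set 'cV[R]_3) : @convex_set R 'cV[R]_3 C <->
  forall x y (t : R), 0 <= t <= 1 -> C x -> C y -> C (t *: x + (1 - t) *: y).
Proof.
split=> [convC x y t /andP[t0 t1] Cx Cy|convC x y t].
  exact: set_mem (convC x y (Itv01 t0 t1) (mem_set Cx) (mem_set Cy)).
move=> /set_mem Cx /set_mem Cy; apply/mem_set/(convC _ _ t%:num) => //.
by rewrite ge0 le1.
Qed.

Variable C : set 'cV[R]_3.
Hypotheses (convC : @convex_set R 'cV[R]_3 C) (C0 : C 0).

(** The missing weight, 1 - a - b, goes to the origin. *)
Lemma convex0_comb2 a b x y :
  0 <= a -> 0 <= b -> a + b <= 1 -> C x -> C y -> C (a *: x + b *: y).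
Proof.
move=> a0 b0 ab1 Cx Cy; have /convex_setP convC' := convC.
have [a1|a_neq1] := eqVneq a 1.
  by rewrite a1 (_ : b = 0) ?scale1r ?scale0r ?addr0 //; lra.
have a_lt1 : 0 < 1 - a by rewrite subr_gt0 lt_neqAle a_neq1; lra.
have b01 : 0 <= b / (1 - a) <= 1.
  by rewrite divr_ge0 ?(ltW a_lt1) //= ler_pdivrMr // mul1r; lra.
have a01 : 0 <= a <= 1 by apply/andP; split; lra.
have := convC' _ _ _ a01 Cx (convC' _ _ _ b01 Cy C0).
by rewrite scaler0 addr0 scalerA mulrC divfK ?gt_eqF.
Qed.

Lemma convex0_comb3 a b c x y z : 0 <= a -> 0 <= b -> 0 <= c ->
  a + b + c <= 1 -> C x -> C y -> C z -> C (a *: x + b *: y + c *: z).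
Proof.
move=> a0 b0 c0 abc1 Cx Cy Cz; have /convex_setP convC' := convC.
have [a1|a_neq1] := eqVneq a 1.
  have [-> ->] : b = 0 /\ c = 0 by split; lra.
  by rewrite a1 scale1r !scale0r !addr0.
have a_lt1 : 0 < 1 - a by rewrite subr_gt0 lt_neqAle a_neq1; lra.
have a01 : 0 <= a <= 1 by apply/andP; split; lra.
have Cyz : C ((b / (1 - a)) *: y + (c / (1 - a)) *: z).
  apply: convex0_comb2; rewrite ?divr_ge0 ?(ltW a_lt1) //.
  by rewrite -mulrDl ler_pdivrMr // mul1r; lra.
have := convC' _ _ _ a01 Cx Cyz.
have cancel u : (1 - a) * (u / (1 - a)) = u by rewrite mulrC divfK ?gt_eqF.
by rewrite scalerDr !scalerA !cancel addrA.
Qed.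

End ConvexSets.

(** * The inner product and planes *)

Section Dot.
Variable R : realType.
Implicit Types (n x y : 'cV[R]_3) (a c : R).

Definition dot n x : R := (n^T *m x) 0 0.

Lemma dotDl n m x : dot (n + m) x = dot n x + dot m x.
Proof. by rewrite /dot linearD mulmxDl mxE. Qed.
Lemma dotDr n x y : dot n (x + y) = dot n x + dot n y.
Proof. by rewrite /dot mulmxDr mxE. Qed.
Lemma dotZl a n x : dot (a *: n) x = a * dot n x.
Proof. by rewrite /dot linearZ -scalemxAl mxE. Qed.
Lemma dotZr a n x : dot n (a *: x) = a * dot n x.
Proof. by rewrite /dot -scalemxAr mxE. Qed.
Lemma dotNl n x : dot (- n) x = - dot n x.
Proof. by rewrite -scaleN1r dotZl mulN1r. Qed.
Lemma dotNr n x : dot n (- x) = - dot n x.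
Proof. by rewrite -scaleN1r dotZr mulN1r. Qed.
Lemma dot0r n : dot n 0 = 0.
Proof. by rewrite /dot mulmx0 mxE. Qed.
Lemma dot0l x : dot 0 x = 0.
Proof. by rewrite /dot trmx0 mul0mx mxE. Qed.

Definition dotE := (dotDl, dotDr, dotNl, dotNr, dotZl, dotZr, dot0l, dot0r).

Lemma dotC n x : dot n x = dot x n.
Proof. by rewrite /dot -[in RHS](trmxK n) -trmx_mul [RHS]mxE. Qed.

Lemma dot_mulmx n (A : 'M_3) x : dot n (A *m x) = dot (A^T *m n) x.
Proof. by rewrite /dot trmx_mul trmxK mulmxA. Qed.

(** The plane spanned by [x], [y], [z] misses the origin, so the three vectors
    are a basis.  In terms of ranks: the vectors orthogonal to [y - x] and
    [z - x] form a line, on which both [m] and [n] lie, and [m] is not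
    orthogonal to [x] while [n] is. *)
Lemma plane_unique n m c x y z : c != 0 ->
  dot m x = c -> dot m y = c -> dot m z = c ->
  dot n x = 0 -> dot n y = 0 -> dot n z = 0 ->
  \rank (row_mx (y - x) (z - x)) = 2%N -> n = 0.
Proof.
move=> c0 mx my mz nx ny nz rk; set A := row_mx _ _ in rk.
have orthA p : dot p y = dot p x -> dot p z = dot p x -> (p^T <= kermx A)%MS.
  move=> py pz; apply/sub_kermxP; rewrite mul_mx_row.
  have dot0 w : dot p w = 0 -> p^T *m w = 0.
    by move=> pw; apply/matrixP => i j; rewrite !ord1 [RHS]mxE.
  by rewrite !dot0 ?row_mx0 // !dotE ?py ?pz subrr.
have mA : (m^T <= kermx A)%MS by apply: orthA; rewrite ?my ?mz mx.
have nA : (n^T <= kermx A)%MS by apply: orthA; rewrite ?ny ?nz nx.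
have rkm : \rank m^T = 1%N.
  rewrite rank_rV -trmx0 (inj_eq trmx_inj); case: eqVneq => // m0.
  by move: c0; rewrite -mx m0 dotE eqxx.
have : (kermx A <= m^T)%MS.
  by rewrite -(mxrank_leqif_sup mA).2 rkm mxrank_ker rk.
move=> /(submx_trans nA)/sub_rVP[a eq_n].
have {}eq_n : n = a *: m by apply: trmx_inj; rewrite linearZ.
move: nx; rewrite eq_n dotE mx => /eqP; rewrite mulf_eq0 (negPf c0) orbF.
by move=> /eqP->; rewrite scale0r.
Qed.

End Dot.

(** * The polyhedron as an intersection of half-spaces *)

Section Tetrahedron.
Variable R : realType.
Implicit Types (n x y z : 'cV[R]_3) (i j k l : 'I_4) (s : {perm 'I_4}).

Definition vtx j : 'cV[R]_3 := col j (tetra R).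

Lemma dot_vtx i j : dot (vtx i) (vtx j) = if i == j then 3 else -1.
Proof.
transitivity (((tetra R)^T *m tetra R) i j).
  by rewrite /dot !mxE; apply: eq_bigr => p _; rewrite !mxE.
by rewrite tetra_tr_mul !mxE; case: eqVneq => _ /=; rewrite ?mulr1n ?mulr0n;
  lra.
Qed.

Lemma sum_vtx : \sum_j vtx j = 0.
Proof.
have := congr1 (col 0) (tetra_mul_const R 1); move=> /matrixP eq0.
apply/matrixP => i j; have := eq0 i j; rewrite !mxE => <-; rewrite summxE.
by apply: eq_bigr => m _; rewrite !mxE mulr1.
Qed.

Lemma vtx_decomp x : x = 4^-1 *: \sum_j dot (vtx j) x *: vtx j.
Proof.
have : tetra R *m ((tetra R)^T *m x) = 4 *: x.
  by rewrite mulmxA tetra_mul_tr mul_scalar_mx.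
move=> /(congr1 ( *:%R 4^-1)); rewrite scalerA mulVf ?pnatr_eq0 // scale1r =>
  {1}<-.
congr (_ *: _); apply/matrixP => i j; rewrite mxE summxE; apply: eq_bigr => m _.
rewrite ord1 /dot !mxE mulrC; congr (_ * _).
by apply: eq_bigr => p _; rewrite !mxE.
Qed.

Lemma sum_dot_vtx x : \sum_j dot (vtx j) x = 0.
Proof.
have <- : dot (\sum_j vtx j) x = \sum_j dot (vtx j) x.
  by apply: (big_morph (fun u => dot u x)) => [u v|]; rewrite dotE.
by rewrite sum_vtx dotE.
Qed.

(** Outward normal of the face whose vertices are [apex k] and the two [vtx i]
    with [i] distinct from [k] and [l]; see [dot_normal_vtx] and
    [dot_normal_apex]. *)
Definition normal k l : 'cV[R]_3 := - (2 *: vtx k + vtx l).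

Lemma dot_normal k l x :
  dot (normal k l) x = - (2 * dot (vtx k) x + dot (vtx l) x).
Proof. by rewrite /normal !dotE. Qed.

Lemma dot_normal_vtx k l j : k != l ->
  dot (normal k l) (vtx j) = if j == k then -5 else if j == l then -1 else 3.
Proof.
move=> kl; rewrite dot_normal !dot_vtx !(eq_sym _ j).
by case: (eqVneq j k) => [->|_]; rewrite ?(negPf kl); try (case: ifP => _); lra.
Qed.

Definition apex j : 'cV[R]_3 := - (3 / 5) *: vtx j.

Lemma dot_normal_apex k l j : k != l ->
  dot (normal k l) (apex j) = if j == k then 3 else if j == l then 3 / 5 else -
    (9 / 5).
Proof.
move=> kl; rewrite /apex dotZr dot_normal_vtx //.
by case: ifP => _; try (case: ifP => _); lra.
Qed.

(** The inverse comes from the conventions: permutations compose from left to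
    right, matrices from right to left. *)
Lemma perm_isometry_vtx s j : perm_isometry R s *m vtx j = vtx ((s^-1)%g j).
Proof.
rewrite /vtx colE mulmxA perm_isometry_tetra -colE -[s in LHS]invgK -col_permE.
by apply/matrixP => p q; rewrite !mxE.
Qed.

Lemma vtx0 : vtx (ord4 0) = const_mx 1.
Proof. by apply/matrixP => p q; rewrite !mxE. Qed.

Lemma orbit_of_vtx a :
  orbit_of (full_tetrahedral_group R) (const_mx a) = range (fun j => a *: vtx
    j).
Proof.
have -> : const_mx a = a *: vtx (ord4 0).
  by rewrite vtx0; apply/matrixP => p q; rewrite !mxE mulr1.
rewrite full_tetrahedral_groupE /orbit_of; apply/seteqP.
split=> [_ [_ [s _ <-] <-]|_ [j _ <-]].
  by exists (s^-1 (ord4 0))%g; rewrite // -scalemxAr perm_isometry_vtx.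
exists (perm_isometry R (tperm (ord4 0) j)); first by exists (tperm (ord4 0) j).
by rewrite -scalemxAr perm_isometry_vtx tpermV tpermL.
Qed.

Lemma triakisE :
  triakis_tetrahedron R = convex_hull (range vtx `|` range apex).
Proof.
rewrite /triakis_tetrahedron !orbit_of_vtx.
have -> // : (fun j => 1 *: vtx j) = vtx by apply/funext => j; rewrite scale1r.
Qed.

Local Notation P := (triakis_tetrahedron R).

Lemma triakis_convex : @convex_set R 'cV[R]_3 P.
Proof.
rewrite triakisE; apply/convex_setP => x y t t01 Px Py C [convC subC].
by have /convex_setP := convC; apply; [|apply: Px|apply: Py].
Qed.

Lemma triakis_vtx j : P (vtx j).
Proof. by rewrite triakisE => C [_]; apply; left; exists j. Qed.

Lemma triakis_apex j : P (apex j).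
Proof. by rewrite triakisE => C [_]; apply; right; exists j. Qed.

Lemma triakis0 : P 0.
Proof.
have /convex_setP convP := triakis_convex.
have half01 : 0 <= (2^-1 : R) <= 1 by apply/andP; split; lra.
have := convP _ _ _ half01
  (convP _ _ _ half01 (triakis_vtx (ord4 0)) (triakis_vtx (ord4 1)))
  (convP _ _ _ half01 (triakis_vtx (ord4 2)) (triakis_vtx (ord4 3))).
congr P; apply/matrixP => -[[|[|[|p]]] //= ?] q; rewrite !mxE /=; lra.
Qed.

Lemma max_normal x : exists k l, k != l /\
  forall k' l', k' != l' -> dot (normal k' l') x <= dot (normal k l) x.
Proof.
have ne01 : (ord4 0, ord4 1).1 != (ord4 0, ord4 1).2 by [].
case: (@Order.TotalTheory.arg_maxP _ _ _ (ord4 0, ord4 1) (fun p => p.1 != p.2)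
  (fun p => dot (normal p.1 p.2) x) ne01) => -[k l] /= kl maxkl.
by exists k, l; split=> // k' l' kl'; apply: (maxkl (k', l')).
Qed.

(** Write b_m for the inner product of v_m and x.  Maximality of (k, l) says
    that b_k is the smallest of the b_m and b_l the second smallest.  As the
    v_m sum to zero, b_l can be subtracted from all the coefficients of
    x = (sum of b_m v_m) / 4, which leaves nonnegative coefficients on v_i and
    v_j, and a nonpositive one on v_k, hence a nonnegative one on apex k. *)
Lemma triakis_halfspaces x :
  P x <-> forall k l, k != l -> dot (normal k l) x <= 3.
Proof.
split=> [Px k l kl|le3].
  apply: (Px [set x | dot (normal k l) x <= 3]); split.
    apply/convex_setP => y z t /andP[t0 t1] /= yle zle.
    rewrite dotDr !dotZr.
    have -> : 3 = t * 3 + (1 - t) * 3 by ring.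
    by apply: lerD; apply: ler_wpM2l; rewrite ?subr_ge0.
  rewrite !orbit_of_vtx => _ [[j _ <-]|[j _ <-]] /=.
    rewrite scale1r dot_normal_vtx //.
    by case: ifP => _; try (case: ifP => _); lra.
  rewrite -/(apex j) dot_normal_apex //.
  by case: ifP => _; try (case: ifP => _); lra.
have [k [l [kl maxkl]]] := max_normal x.
have [i [j ijkl]] := quadrupleP kl.
have [/and5P[_ ki kj li /andP[lj ij]] _] := ijkl.
pose b m := dot (vtx m) x.
have sum_b : b k + b l + b i + b j = 0 by rewrite -(quadruple_sum _ ijkl)
  sum_dot_vtx.
have bkl : b k <= b l.
  by have := maxkl l k; rewrite eq_sym kl !dot_normal -!/(b _) => /(_ isT); lra.
have bli : b l <= b i.
  by have := maxkl k i ki; rewrite !dot_normal -!/(b _); lra.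
have blj : b l <= b j.
  by have := maxkl k j kj; rewrite !dot_normal -!/(b _); lra.
have := le3 k l kl; rewrite dot_normal -!/(b _) => le3kl.
have comb (vk vl vi vj : 'cV[R]_3) : vk + vl + vi + vj = 0 ->
    4^-1 *: (b k *: vk + b l *: vl + b i *: vi + b j *: vj) =
    ((b i - b l) / 4) *: vi + ((b j - b l) / 4) *: vj
    + (5 / 12 * (b l - b k)) *: (- (3 / 5) *: vk).
  move=> sum0; have -> : vl = - (vk + vi + vj).
    by apply/eqP; rewrite -addr_eq0 !addrA (addrC vl) sum0.
  by apply/matrixP => p q; rewrite !mxE; field.
rewrite (vtx_decomp x) (quadruple_sum _ ijkl) -!/(b _) comb; last first.
  by rewrite -(quadruple_sum _ ijkl) sum_vtx.
apply: (convex0_comb3 triakis_convex triakis0); rewrite -?/(apex k).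
- by rewrite divr_ge0 ?subr_ge0.
- by rewrite divr_ge0 ?subr_ge0.
- by rewrite mulr_ge0 ?subr_ge0 // divr_ge0.
- lra.
- exact: triakis_vtx.
- exact: triakis_vtx.
- exact: triakis_apex.
Qed.

End Tetrahedron.

(** * The faces and the action of S_4 on them *)

Section Faces.
Variable R : realType.
Implicit Types (n x y z : 'cV[R]_3) (i j k l : 'I_4) (s : {perm 'I_4}).
Local Notation P := (triakis_tetrahedron R).

Definition triangle k l : set 'cV[R]_3 :=
  [set x | P x /\ dot (normal R k l) x = 3].

Lemma triangle_vtx k l i : k != l -> triangle k l (vtx R i) <-> i != k /\ i !=
  l.
Proof.
move=> kl; rewrite /triangle /= dot_normal_vtx //; split=> [[_]|[ik il]].
  by case: eqVneq => _; [|case: eqVneq => // _]; move=> eq3; exfalso; lra.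
by split; [exact: triakis_vtx|rewrite (negPf ik) (negPf il)].
Qed.

Lemma triangle_apex k l i : k != l -> triangle k l (apex R i) <-> i = k.
Proof.
move=> kl; rewrite /triangle /= dot_normal_apex //; split=> [[_]|->].
  by case: eqVneq => // _; case: eqVneq => _ eq3; exfalso; lra.
by split; [exact: triakis_apex|rewrite eqxx].
Qed.

(** The vertices of a triangle determine [k], as the index of its apex, and then
    [l], as the index other than [k] whose [vtx] it misses. *)
Lemma triangle_inj k l k' l' : k != l -> k' != l' ->
  triangle k l = triangle k' l' -> k = k' /\ l = l'.
Proof.
move=> kl kl' eqF.
have eqk : k = k'.
  by apply/(triangle_apex k kl'); rewrite -eqF; apply/triangle_apex.
move: eqF kl'; rewrite -{}eqk => eqF kl'.
split=> //; apply/eqP; rewrite eq_sym; apply/negP => /negP ll'.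
have : triangle k l (vtx R l') by apply/triangle_vtx => //; rewrite eq_sym.
by rewrite eqF => /(triangle_vtx _ kl')[_]; rewrite eqxx.
Qed.

Lemma triangle_rank k l i j : quadruple k l i j ->
  \rank (row_mx (vtx R j - vtx R i) (apex R k - vtx R i)) = 2%N.
Proof.
move=> [/and5P[kl ki kj li /andP[lj ij]] _]; set A := row_mx _ _.
have entry u v (B : 'M[R]_1) : dot u v = B 0 0 -> u^T *m v = B.
  by move=> eq_uv; apply/matrixP => p q; rewrite !ord1.
(* A left inverse of [A]: [v_j - v_l] is orthogonal to [apex k - v_i], and
   [v_k - v_l] to [v_j - v_i]. *)
pose B := col_mx (4^-1 *: (vtx R j - vtx R l))^T
                 (- (5 / 12) *: (vtx R k - vtx R l))^T.
have BA : B *m A = 1%:M.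
  rewrite mul_col_row (@scalar_mx_block _ 1 1).
  have sym_neq (p q : 'I_4) : p != q -> (p == q) = false /\ (q == p) = false.
    by rewrite (eq_sym q) => /negPf.
  have [[kl0 lk0] [ki0 ik0] [kj0 jk0]] :=
    And3 (sym_neq _ _ kl) (sym_neq _ _ ki) (sym_neq _ _ kj).
  have [[li0 il0] [lj0 jl0] [ij0 ji0]] :=
    And3 (sym_neq _ _ li) (sym_neq _ _ lj) (sym_neq _ _ ij).
  have neqs := (kl0, lk0, ki0, ik0, kj0, jk0, li0, il0, lj0, jl0, ij0, ji0).
  by congr block_mx; apply: entry;
    rewrite !mxE /apex !dotE !dot_vtx ?eqxx ?neqs /= ?mulr1n ?mulr0n; lra.
have /esym rkBA := congr1 mxrank BA; rewrite mxrank1 in rkBA.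
apply/eqP; rewrite eqn_leq rank_leq_col /=.
by apply: leq_trans (mxrankM_maxr B A); rewrite -rkBA.
Qed.

(** For a face [F] in the plane n . x = c, c is positive since the v_j sum to
    zero.  Let w / 3 be the centroid of three noncollinear points of [F], and
    (k, l) a pair maximising n_kl . w.  If n_kl . w < 9, then t w is still in
    the polyhedron for some t > 1/3, yet it is beyond the supporting plane.  So
    n_kl . w >= 9, and each of the three points, which contributes at most 3, is
    in the plane n_kl . x = 3; hence n is a multiple of n_kl. *)
Lemma facesP F :
  faces P F <-> exists k l, k != l /\ F = triangle k l.
Proof.
split=> [[n [c [n0 lec -> [x [y [z [[Px nx] [Py ny] [Pz nz] rk]]]]]]]|[k [l [kl
  ->]]]].
  have {}lec u : P u -> dot n u <= c := lec u.
  have {}nx : dot n x = c := nx.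
  have {}ny : dot n y = c := ny.
  have {}nz : dot n z = c := nz.
  have c_gt0 : 0 < c.
    rewrite ltNge; apply/negP => c_le0; case/eqP: n0.
    have nj j : dot (vtx R j) n <= 0.
      by rewrite dotC; apply: le_trans (lec _ (triakis_vtx j)) c_le0.
    have : \sum_j - dot (vtx R j) n == 0 by rewrite sumrN sum_dot_vtx oppr0.
    rewrite psumr_eq0 => [/allP nj0|j _]; last by rewrite oppr_ge0.
    rewrite (vtx_decomp n) big1 ?scaler0 // => j _.
    have := nj0 j (mem_index_enum j); rewrite oppr_eq0 => /eqP ->.
    by rewrite scale0r.
  pose w := x + y + z.
  have [k [l [kl maxkl]]] := max_normal w.
  have /triakis_halfspaces/(_ k l kl) mx := Px.
  have /triakis_halfspaces/(_ k l kl) my := Py.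
  have /triakis_halfspaces/(_ k l kl) mz := Pz.
  exists k, l; split=> //.
  have mw : 9 <= dot (normal R k l) w.
    rewrite leNgt; apply/negP => mw_lt.
    have [t t1 tw] : exists2 t : R, 3^-1 < t & t * dot (normal R k l) w <= 3.
      have [mw_gt0|mw_le0] := ltP 0 (dot (normal R k l) w).
        exists (3 / dot (normal R k l) w); last by rewrite divfK ?gt_eqF.
        by rewrite ltr_pdivlMr //; lra.
      exists 1; lra.
    have Ptw : P (t *: w).
      apply/triakis_halfspaces => k' l' kl'; rewrite dotZr; apply: le_trans tw.
      by apply: ler_wpM2l (maxkl _ _ kl'); lra.
    have := lec _ Ptw; rewrite dotZr /w !dotDr nx ny nz.
    have -> : t * (c + c + c) = c * (3 * t) by ring.
    apply/negP; rewrite -ltNge ltr_pMr //; lra.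
  rewrite /w !dotDr in mw.
  have {}mx : dot (normal R k l) x = 3 by lra.
  have {}my : dot (normal R k l) y = 3 by lra.
  have {}mz : dot (normal R k l) z = 3 by lra.
  have : n - (c / 3) *: normal R k l = 0.
    have c3 : (3 : R) != 0 by rewrite pnatr_eq0.
    by apply: (plane_unique c3 mx my mz _ _ _ rk);
      rewrite dotDl dotNl dotZl ?mx ?my ?mz ?nx ?ny ?nz divfK // subrr.
  move=> /eqP; rewrite subr_eq0 => /eqP eq_n.
  apply/seteqP; split=> u /= [Pu eq_u]; split=> //.
    have := eq_u; rewrite -/(dot n u) eq_n dotZl => eqc.
    have c0 : c / 3 != 0 by rewrite mulf_neq0 ?gt_eqF // invr_gt0 ltr0n.
    apply: (mulfI c0); rewrite eqc divfK //; exact: lt0r_neq0.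
  by rewrite -/(dot n u) eq_n dotZl eq_u divfK // pnatr_eq0.
have [i [j klij]] := quadrupleP kl.
have [/and5P[_ ki kj li /andP[lj _]] _] := klij.
have Fi : triangle k l (vtx R i) by apply/triangle_vtx; rewrite // !(eq_sym i).
have Fj : triangle k l (vtx R j) by apply/triangle_vtx; rewrite // !(eq_sym j).
have Fk : triangle k l (apex R k) by apply/triangle_apex.
exists (normal R k l), 3; split=> //.
- apply/eqP => n0; have [_] := Fi; rewrite n0 dot0l => /eqP.
  by rewrite eq_sym pnatr_eq0.
- by move=> x /triakis_halfspaces; apply.
by exists (vtx R i), (vtx R j), (apex R k); split=> //;
  apply: triangle_rank klij.
Qed.

Lemma perm_isometry_normal s k l :
  (perm_isometry R s)^T *m normal R k l = normal R (s k) (s l).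
Proof.
rewrite /normal perm_isometry_tr mulmxN mulmxDr -scalemxAr.
by rewrite !perm_isometry_vtx invgK.
Qed.

Lemma perm_isometry_triangle s k l : k != l ->
  [set perm_isometry R s *m x | x in triangle k l] =
  triangle ((s^-1)%g k) ((s^-1)%g l).
Proof.
have sub (r : {perm 'I_4}) k' l' x : triangle k' l' x ->
    triangle ((r^-1)%g k') ((r^-1)%g l') (perm_isometry R r *m x).
  move=> [/triakis_halfspaces Px eqx]; split; last first.
    by rewrite dot_mulmx perm_isometry_normal !permKV.
  apply/triakis_halfspaces => k1 l1 kl1.
  by rewrite dot_mulmx perm_isometry_normal; apply: Px;
    rewrite (inj_eq perm_inj).
move=> kl; apply/seteqP; split=> [_ [x Fx <-]|x Fx]; first exact: sub.
exists (perm_isometry R s^-1 *m x).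
  by have := sub (s^-1)%g _ _ _ Fx; rewrite invgK !permKV.
by rewrite mulmxA -perm_isometryM mulgV perm_isometry1 mul1mx.
Qed.

End Faces.

(** * The regular action of A_4 on the faces, and the count *)

Section RegularAction.
Variable R : realType.
Local Notation P := (triakis_tetrahedron R).
Implicit Types (u v : [subg A4]).

Lemma alt_triangle_subproof u :
  triangle (R := R) ((sgval u)^-1%g (ord4 0)) ((sgval u)^-1%g (ord4 1)) \in
    faces P.
Proof.
apply/mem_set/facesP; do 2!eexists; split; last by [].
by rewrite (inj_eq perm_inj).
Qed.

Definition alt_triangle u : faces P := SigSub (alt_triangle_subproof u).

(** The faces are the triangles [k l] with [k] and [l] distinct, and exactly one
    element of A_4 sends the pair (0, 1) to a given such pair. *)
Lemma alt_triangle_bij : bijective alt_triangle.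
Proof.
have ne01 : ord4 0 != ord4 1 by [].
rewrite -setTT_bijective; split=> // [u v _ _|[F inF] _].
  move=> /(congr1 val)/triangle_inj; rewrite !(inj_eq perm_inj) => /(_ isT isT).
  move=> [eq0 eq1]; apply/val_inj/eqP; rewrite /= eq_mulVg1; apply/eqP.
  have uvA : ((sgval u)^-1 * sgval v)%g \in A4 by rewrite groupM ?groupV ?subgP.
  by apply: (alt4_fix2 ne01 uvA); rewrite permM ?eq0 ?eq1 permKV.
have [k [l [kl defF]]] := (facesP F).1 (set_mem inF).
have [s sA [s0 s1]] := alt4_trans2 ne01 kl.
exists (subg _ s^-1%g) => //; apply: val_inj => /=.
by rewrite subgK ?groupV // invgK s0 s1 defF.
Qed.

Lemma alt_triangleM u v : val (alt_triangle (u * v)%g) =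
  [set perm_isometry R (sgval u) *m x | x in val (alt_triangle v)].
Proof.
rewrite perm_isometry_triangle ?(inj_eq perm_inj) //=.
by rewrite invMg !permM.
Qed.

End RegularAction.

Theorem corollary2 (R : realType) (T : finType)
    (act : 'M[R]_3 -> T * faces (triakis_tetrahedron R) ->
                      T * faces (triakis_tetrahedron R))
    (hact : tile_action (rotational_tetrahedral_group R) act) :
  exists N : nat,
    (tiling_orbits (rotational_tetrahedral_group R) act #= `I_N)%card /\
    N%:R = 1 / 12 * (#|T|%:R ^+ 12 + 8 * #|T|%:R ^+ 4 + 3 * #|T|%:R ^+ 6)
      :> rat.
Proof.
pose M (u : [subg A4]) := perm_isometry R (sgval u).
have M1 : M 1%g = 1%:M by rewrite /M morph1 perm_isometry1.
have MM u v : M (u * v)%g = M u *m M v by rewrite /M morphM ?inE //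
  perm_isometryM.
have rangeM : range M = rotational_tetrahedral_group R.
  rewrite rotational_tetrahedral_groupE; apply/seteqP.
  split=> [_ [u _ <-]|_ [s sA <-]]; first by exists (sgval u) => //=;
    apply: subgP.
  by exists (subg _ s) => //; rewrite /M subgK.
have [N [cardN eqN]] := card_tiling_orbits_regular hact M1 MM rangeM
  (alt_triangle_bij R) (@alt_triangleM R).
exists N; split=> //.
have card_subg4 : #|[subg A4]| = 12%N by rewrite card_sub card_alt4.
have sum12 : (N * 12 = #|T| ^ 12 + 8 * #|T| ^ 4 + 3 * #|T| ^ 6)%N.
  rewrite -sum_alt4_order -{1}card_subg4 eqN card_subg4.
  rewrite (reindex_onto sgval (subg 'Alt_('I_4)%G)); last by move=> s sA;
    rewrite subgK.
  apply: eq_big => [u|u _]; first by rewrite subgP sgvalK eqxx.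
  by rewrite -(order_injm (injm_sgval _)) ?inE.
have := congr1 (fun n => n%:R : rat) sum12.
rewrite !(natrM, natrD, natrX) => eqR; lra.
Qed.
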